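(* Let $f=\frac1n\sum_{i=1}^n f_i$ where each $f_i:\mathbb{R}^d\to\mathbb{R}$ is convex and $L_i$-smooth, let $x^*$ be a minimizer of $f$, and let $L_{\max}=\max_{1\le i\le n}L_i$. Let $c=1$, $\gamma_b\in(0,\infty)$ and $\alpha=\min\left\{\frac{1}{2cL_{\max}},\gamma_b\right\}$. Then the iterates of SGD with $\text{SPS}_{\max}$ (with parameters $c=1$ and $\gamma_b$) satisfy, for every $K\ge1$, $$\mathbb{E}\left[f(\bar{x}^K)-f(x^* )\right]\le\frac{\|x^0-x^*\|^2}{\alpha K}+\frac{2\sigma^2\gamma_b}{\alpha},\qquad \bar{x}^K:=\frac1K\sum_{k=0}^{K-1}x^k.$$
   Context: Setting: $f(x)=\frac1n\sum_{i=1}^n f_i(x)$ is minimized over $\mathbb{R}^d$, and the set $\mathcal{X}^*$ of minimizers of $f$ is nonempty. A function is $L$-smooth if it is differentiable with $L$-Lipschitz gradient. For each $i$, $f_i^*:=\inf_x f_i(x)$, and it is assumed throughout that $\sigma^2:=\mathbb{E}_i[f_i(x^* )-f_i^*]=f(x^* )-\frac1n\sum_{i=1}^n f_i^*<\infty$ (so all $f_i^*$ are finite), where $x^*\in\mathcal{X}^*$. SGD: starting from a deterministic $x^0$, at each iteration $k$ an index $i\in\{1,\dots,n\}$ is drawn uniformly at random, independently of the past, and $x^{k+1}=x^k-\gamma_k\nabla f_i(x^k)$. $\text{SPS}_{\max}$ with parameters $c>0$ and $\gamma_b>0$: $\gamma_k=\min\left\{\frac{f_i(x^k)-f_i^*}{c\|\nabla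 f_i(x^k)\|^2},\gamma_b\right\}$, where $i$ is the index drawn at iteration $k$. If $\nabla f_i(x^k)=0$ then $x^{k+1}=x^k$. *)

(* Defs.v *)
From HB Require Import structures.
From mathcomp Require Import all_boot all_order all_algebra.
From mathcomp Require Import all_classical all_reals all_analysis.

Set Implicit Arguments.
Unset Strict Implicit.
Unset Printing Implicit Defensive.

Import Order.TTheory GRing.Theory Num.Theory.
Import numFieldNormedType.Exports.

Local Open Scope classical_set_scope.
Local Open Scope ring_scope.

(* The canonical norm `|x| on 'rV[R]_d is the sup norm, hence this definition.
   The topology, and so differentiability, is the same for both norms. *)
Definition enorm (R : realType) (d : nat) (x : 'rV[R]_d) : R :=
  Num.sqrt (\sum_(j < d) x 0 j ^+ 2).

Definition gradient (R : realType) (d : nat) (g : 'rV[R]_d -> R)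
    (x : 'rV[R]_d) : 'rV[R]_d :=
  \row_j 'D_(delta_mx 0 j : 'rV[R]_d) g x.

Definition smooth (R : realType) (d : nat) (L : R) (g : 'rV[R]_d -> R) : Prop :=
  (forall x, differentiable g x) /\
  (forall x y, enorm (gradient g x - gradient g y) <= L * enorm (x - y)).

Definition avg_fun (R : realType) (d n : nat) (f : 'I_n -> 'rV[R]_d -> R)
    (x : 'rV[R]_d) : R :=
  n%:R^-1 * \sum_(i < n) f i x.

Definition minimizer (R : realType) (d : nat) (g : 'rV[R]_d -> R)
    (x : 'rV[R]_d) : Prop :=
  forall y, g x <= g y.

(* inf is the infimum only on sets that are bounded below. *)
Definition inf_val (R : realType) (d : nat) (g : 'rV[R]_d -> R) : R :=
  inf (range g).

Definition sigma2 (R : realType) (d n : nat) (f : 'I_n -> 'rV[R]_d -> R)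
    (xs : 'rV[R]_d) : R :=
  n%:R^-1 * \sum_(i < n) (f i xs - inf_val (f i)).

(* For 0 < n and nonnegative L i, the base value 0 does not affect the max. *)
Definition Lmax (R : realType) (n : nat) (L : 'I_n -> R) : R :=
  \big[Num.max/0]_(i < n) L i.

(* 1 / (2 c Lmax) is read as +oo, not as the library's 1 / 0 = 0,
   when Lmax = 0. *)
Definition sps_alpha (R : realType) (n : nat) (c gb : R) (L : 'I_n -> R) : R :=
  if Lmax L == 0 then gb else Num.min (1 / (2 * c * Lmax L)) gb.

Definition sps_max (R : realType) (d : nat) (c gb : R) (g : 'rV[R]_d -> R)
    (x : 'rV[R]_d) : R :=
  Num.min ((g x - inf_val g) / (c * enorm (gradient g x) ^+ 2)) gb.

Definition sps_step (R : realType) (d : nat) (c gb : R) (g : 'rV[R]_d -> R)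
    (x : 'rV[R]_d) : 'rV[R]_d :=
  if gradient g x == 0 then x else x - sps_max c gb g x *: gradient g x.

Fixpoint sgd_sps (R : realType) (d n : nat) (c gb : R)
    (f : 'I_n -> 'rV[R]_d -> R) (x0 : 'rV[R]_d) (idx : nat -> 'I_n)
    (k : nat) : 'rV[R]_d :=
  if k is k'.+1 then sps_step c gb (f (idx k')) (sgd_sps c gb f x0 idx k')
  else x0.

Definition avg_iterate (R : realType) (d : nat) (x : nat -> 'rV[R]_d)
    (K : nat) : 'rV[R]_d :=
  K%:R^-1 *: \sum_(0 <= k < K) x k.

(* Sequences of random indices that are mutually independent and uniform on
   'I_n; every subset of the finite type 'I_n counts as an event. *)
Definition iid_uniform (R : realType) (disp : measure_display)
    (Omega : measurableType disp) (P : probability Omega R) (n : nat)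
    (idx : nat -> Omega -> 'I_n) : Prop :=
  [/\ forall k (A : set 'I_n), measurable (idx k @^-1` A),
      forall k (i : 'I_n), P (idx k @^-1` [set i]) = (n%:R^-1)%:E
    & forall (J : seq nat) (A : nat -> set 'I_n), uniq J ->
        P (\bigcap_(k in [set` J]) (idx k @^-1` A k)) =
        (\prod_(k <- J) P (idx k @^-1` A k))%E].

(* Main.v *)
Require Import Defs.
From HB Require Import structures.
From mathcomp Require Import all_boot all_order all_algebra.
From mathcomp Require Import all_classical all_reals all_analysis.
From mathcomp Require Import measurable_realfun ring lra.

Set Implicit Arguments.
Unset Strict Implicit.
Unset Printing Implicit Defensive.

Import Order.TTheory GRing.Theory Num.Theory.
Import numFieldNormedType.Exports.

Local Open Scope classical_set_scope.
Local Open Scope ring_scope.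

(** The engine is a one-step estimate ([sps_step_le]), valid for every single
    draw: if [0 <= alpha <= gb] and [2 * alpha * L <= 1], a step of the method on
    a convex [L]-smooth function [g] that is bounded below moves [x] to a point
    [x'] with
      |x' - y|^2 <= |x - y|^2 - alpha (g x - g y) + 2 gb (g y - inf g).
    Let G be the gradient of [g] at [x].  If G = 0 then [x] minimizes [g] and
    does not move.  Otherwise expand the square.  Convexity bounds the
    inner product of G with [x - y] below by [g x - g y], and the
    first argument of the minimum defining the step size [gam] gives
    gam |G|^2 <= g x - inf g.  What remains is
    - gam (g x - inf g) + 2 gam (g y - inf g), where both gaps are nonnegative,
    so it suffices that alpha <= gam <= gb.  The bound alpha <= gam is
    alpha |G|^2 <= g x - inf g ([smooth_gap_ge]), which follows from the
    descent lemma applied to the trial step -(2 alpha) G.  This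
    covers the case L = 0 as well.

    Averaging the estimate over a uniform draw turns [g x - g y] into the gap
    of [f] and [g y - inf g] into sigma^2, so summing over [K] steps telescopes.
    Since the iterates up to time [K] are a function of the first [K] draws,
    which form a uniform random [K]-tuple ([expectation_draws]), the
    expectation is a finite average, and the telescoping is an induction on
    the length of the tuple that peels off the first draw
    ([sum_tuple_gap_le]).  Jensen's inequality passes from the average of the
    gaps to the gap at the averaged iterate. *)

(** * The Euclidean inner product *)

(** The standard inner product on row vectors, whose associated norm is
    [enorm]. *)
Definition dotp (R : realType) (d : nat) (x y : 'rV[R]_d) : R :=
  \sum_(j < d) x 0 j * y 0 j.

Section inner_product.
Context {R : realType} {d : nat}.
Implicit Types (x y z : 'rV[R]_d) (a : R).

Lemma dotpC x y : dotp x y = dotp y x.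
Proof. by apply: eq_bigr => j _; rewrite mulrC. Qed.

Lemma dotpDr x y z : dotp x (y + z) = dotp x y + dotp x z.
Proof. by rewrite -big_split; apply: eq_bigr => j _; rewrite mxE mulrDr. Qed.

Lemma dotpZr a x y : dotp x (a *: y) = a * dotp x y.
Proof. by rewrite mulr_sumr; apply: eq_bigr => j _; rewrite mxE mulrCA. Qed.

Lemma dotpNr x y : dotp x (- y) = - dotp x y.
Proof. by rewrite -scaleN1r dotpZr mulN1r. Qed.

Lemma dotpBr x y z : dotp x (y - z) = dotp x y - dotp x z.
Proof. by rewrite dotpDr dotpNr. Qed.

Lemma dotpBl x y z : dotp (x - y) z = dotp x z - dotp y z.
Proof. by rewrite dotpC dotpBr ![dotp z _]dotpC. Qed.

Lemma dotpZl a x y : dotp (a *: x) y = a * dotp x y.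
Proof. by rewrite dotpC dotpZr dotpC. Qed.

Lemma dotp0r x : dotp x 0 = 0.
Proof. by rewrite -(scale0r 0) dotpZr mul0r. Qed.

Lemma dotp0l x : dotp 0 x = 0.
Proof. by rewrite dotpC dotp0r. Qed.

Lemma dotp_sumr x (I : Type) (r : seq I) (F : I -> 'rV[R]_d) :
  dotp x (\sum_(i <- r) F i) = \sum_(i <- r) dotp x (F i).
Proof. exact: (big_morph (dotp x) (dotpDr x) (dotp0r x)). Qed.

Lemma dotpp_ge0 x : 0 <= dotp x x.
Proof. by apply: sumr_ge0 => j _; rewrite -expr2 sqr_ge0. Qed.

Lemma dotpp_eq0 x : (dotp x x == 0) = (x == 0).
Proof.
apply/idP/eqP => [|->]; last by rewrite dotp0r.
rewrite psumr_eq0 => [/allP x0|j _]; last by rewrite -expr2 sqr_ge0.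
apply/rowP => j; have := x0 j (mem_index_enum j).
by rewrite mxE mulf_eq0 orbb => /eqP.
Qed.

Lemma dotpp_subZ a x y :
  dotp (x - a *: y) (x - a *: y) =
  dotp x x - 2 * a * dotp y x + a ^+ 2 * dotp y y.
Proof. rewrite dotpBr !dotpBl !(dotpZr, dotpZl) (dotpC x y); ring. Qed.

Lemma enorm_sqr x : enorm x ^+ 2 = dotp x x.
Proof. by rewrite sqr_sqrtr ?sumr_ge0// => j _; rewrite sqr_ge0. Qed.

Lemma enorm_ge0 x : 0 <= enorm x.
Proof. exact: sqrtr_ge0. Qed.

Lemma enorm_gt0 x : x != 0 -> 0 < enorm x.
Proof. by rewrite lt_def enorm_ge0 andbT -dotpp_eq0 -enorm_sqr sqrf_eq0. Qed.

Lemma enormZ a x : enorm (a *: x) = `|a| * enorm x.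
Proof.
rewrite -sqrtr_sqr -sqrtrM ?sqr_ge0//; congr Num.sqrt.
by rewrite mulr_sumr; apply: eq_bigr => j _; rewrite mxE exprMn.
Qed.

(** The Cauchy-Schwarz inequality. *)
Lemma dotp_le_enorm x y : dotp x y <= enorm x * enorm y.
Proof.
have [->|/enorm_gt0 x0] := eqVneq x 0.
  by rewrite dotp0l mulr_ge0 ?enorm_ge0.
have [->|/enorm_gt0 y0] := eqVneq y 0.
  by rewrite dotp0r mulr_ge0 ?enorm_ge0.
have := dotpp_ge0 (enorm y *: x - enorm x *: y).
rewrite !(dotpBr, dotpBl, dotpZr, dotpZl) -!enorm_sqr (dotpC y x) => h.
have xy0 := mulr_gt0 x0 y0.
rewrite -(ler_pM2l xy0); lra.
Qed.

End inner_product.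

(** * Smooth and convex functions along a line *)

Section gradient.
Context {R : realType} {d : nat}.
Implicit Types (g : 'rV[R]_d -> R) (x y v : 'rV[R]_d).

Lemma derive_dotp_gradient g x v :
  differentiable g x -> 'D_v g x = dotp (gradient g x) v.
Proof.
move=> dg; rewrite deriveE// [in LHS](row_sum_delta v) linear_sum.
by apply: eq_bigr => j _; rewrite linearZ /= mxE deriveE// mulrC.
Qed.

(** The chain rule along a line. *)
Lemma is_derive_line g x v (t : R) :
  differentiable g (x + t *: v) ->
  is_derive t 1 (fun s : R => g (x + s *: v))
    (dotp (gradient g (x + t *: v)) v).
Proof.
move=> dg; rewrite -derive_dotp_gradient//.
have quotE : (fun h : R => h^-1 *:
    (((fun s : R => g (x + s *: v)) \o shift t) (h *: 1) - g (x + t *: v))) =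
  (fun h : R => h^-1 *: ((g \o shift (x + t *: v)) (h *: v) - g (x + t *: v))).
  apply/funext => h /=; congr (_ *: (g _ - _)).
  have -> : h *: (1 : R) = h by exact: mulr1.
  by rewrite scalerDl addrCA.
have := @diff_derivable _ _ _ _ _ v dg; rewrite /derivable => dgv.
by apply: DeriveDef; rewrite /derivable /derive quotE.
Qed.

(** A convex function lies above its tangent hyperplanes: for h in (0, 1],
    convexity bounds the difference quotient in the direction [y - x] by
    [g y - g x]; let h tend to 0 from the right. *)
Lemma convex_ge_gradient g x y : convex_function [set: 'rV[R]_d] g ->
  differentiable g x -> g x + dotp (gradient g x) (y - x) <= g y.
Proof.
move=> cg dg; rewrite -derive_dotp_gradient// -lerBrDl.
have dgv := @diff_derivable _ _ _ _ _ (y - x) dg.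
have cvg_r := cvg_dnbhs_at_right dgv.
rewrite /derive -(cvg_lim _ cvg_r)//.
apply: limr_le; first by apply/cvg_ex; exists ('D_(y - x) g x).
near=> h.
have h0 : 0 < h by near: h; exact: nbhs_right_gt.
have h1 : h <= 1 by near: h; apply: nbhs_right_le; exact: ltr01.
rewrite /GRing.scale /= mulrC ler_pdivrMr//.
have := cg (Itv01 (ltW h0) h1) y x (mem_setT _) (mem_setT _).
rewrite convRE /= /unstable.onem.
have -> : conv (Itv01 (ltW h0) h1) (y : convex_lmodType 'rV[R]_d) x =
    h *: (y - x) + x.
  by rewrite /conv /= /unstable.onem scalerBr scalerBl scale1r addrA addrAC.
lra.
Unshelve. all: by end_near. Qed.

(** The descent lemma.  Without integrals: the auxiliary function [p] below
    has a nonpositive derivative on [0, 1], by Cauchy-Schwarz and the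
    Lipschitz bound on the gradient. *)
Lemma smooth_descent (L : R) g x v : smooth L g ->
  g (x + v) <= g x + dotp (gradient g x) v + L / 2 * dotp v v.
Proof.
move=> [dg lipg].
pose p (t : R) := g (x + t *: v) -
  (t * dotp (gradient g x) v + t ^+ 2 * (L / 2 * dotp v v)).
have dp (t : R) : is_derive t 1 p (dotp (gradient g (x + t *: v)) v -
    (dotp (gradient g x) v + t * (L * dotp v v))).
  have dl := is_derive_line (dg (x + t *: v)).
  rewrite /p; apply: is_derive_eq; rewrite /GRing.scale /=; lra.
have : p 1 <= p 0.
  apply: (@ler0_derive1_nincr _ p 0 1) => //.
  - move=> t; rewrite in_itv /= => /andP[t0 _].
    rewrite derive1E derive_val opprD addrA -dotpBl subr_le0.
    apply: le_trans (dotp_le_enorm _ _) _.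
    apply: le_trans (ler_wpM2r (enorm_ge0 _) (lipg _ _)) _.
    by rewrite addrC addKr enormZ gtr0_norm// -enorm_sqr; lra.
  - by apply: derivable_within_continuous => t _.
by rewrite /p scale1r scale0r addr0; lra.
Qed.

Lemma inf_val_le g x : has_lbound (range g) -> inf_val g <= g x.
Proof. by move=> lbg; apply: ge_inf => //; exists x. Qed.

(** When the gradient is nonzero, this says that the Polyak quotient (with
    c = 1) is at least [alpha].  The trial step [2 * alpha], rather than 1 / L, makes the argument uniform in [L], with
    no division by [L]. *)
Lemma smooth_gap_ge (L alpha : R) g x :
  smooth L g -> has_lbound (range g) -> 0 <= alpha -> 2 * alpha * L <= 1 ->
  alpha * dotp (gradient g x) (gradient g x) <= g x - inf_val g.
Proof.
move=> sg lbg a0 aL; set G := gradient g x.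
have := smooth_descent x (- (2 * alpha) *: G) sg.
rewrite -/G !(dotpZr, dotpZl).
have := inf_val_le (x + - (2 * alpha) *: G) lbg.
have /(ler_wpM2r (mulr_ge0 a0 (dotpp_ge0 G))) := aL.
lra.
Qed.

End gradient.

(** * One step of the method *)

Section step.
Context {R : realType} {d : nat}.
Implicit Types (g : 'rV[R]_d -> R) (x y : 'rV[R]_d).

Lemma sps_step_le (L alpha gb : R) g x y :
  convex_function [set: 'rV[R]_d] g -> smooth L g -> has_lbound (range g) ->
  0 <= alpha -> alpha <= gb -> 2 * alpha * L <= 1 ->
  enorm (sps_step 1 gb g x - y) ^+ 2 <=
    enorm (x - y) ^+ 2 - alpha * (g x - g y) + 2 * gb * (g y - inf_val g).
Proof.
move=> cg sg lbg a0 agb aL.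
have gb0 := le_trans a0 agb.
have gap := smooth_gap_ge x sg lbg a0 aL.
have gy0 : 0 <= g y - inf_val g by rewrite subr_ge0 inf_val_le.
have gx0 : 0 <= g x - inf_val g by rewrite subr_ge0 inf_val_le.
have := convex_ge_gradient y cg (sg.1 x).
rewrite /sps_step; case: eqVneq => [-> | G0].
  (* The gradient vanishes, so x minimizes g and does not move. *)
  rewrite dotp0l addr0 => gxy.
  have ay := mulr_ge0 gb0 gy0.
  have : 0 <= alpha * (g y - g x) by rewrite mulr_ge0 ?subr_ge0.
  lra.
rewrite /sps_max mul1r !enorm_sqr.
set G := gradient g x in G0 gap *.
have GG0 : 0 < dotp G G by rewrite lt_def dotpp_eq0 G0 dotpp_ge0.
set gam := Num.min _ _.
have agam : alpha <= gam by rewrite le_min agb andbT ler_pdivlMr.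
have gamgb : gam <= gb by rewrite ge_min lexx orbT.
have gamG : gam * dotp G G <= g x - inf_val g.
  by rewrite -ler_pdivlMr// ge_min lexx.
have gam0 := le_trans a0 agam.
rewrite -opprB dotpNr => cvx.
rewrite addrAC; move: cvx; set u := x - y => cvx.
rewrite dotpp_subZ.
have := ler_wpM2l gam0 cvx; have := ler_wpM2l gam0 gamG.
have := ler_wpM2r gx0 agam; have := ler_wpM2r gy0 gamgb.
have := mulr_ge0 a0 gy0.
lra.
Qed.

End step.

(** * Convexity and averages *)

(** Jensen's inequality for a differentiable convex function: average the
    tangent inequalities at the mean, where the linear terms cancel. *)
Lemma convex_avg_iterate (R : realType) (d : nat) (g : 'rV[R]_d -> R)
    (x : nat -> 'rV[R]_d) K :
  convex_function [set: 'rV[R]_d] g -> (forall y, differentiable g y) ->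
  (0 < K)%N ->
  g (avg_iterate x K) <= K%:R^-1 * \sum_(0 <= k < K) g (x k).
Proof.
move=> cg dg K0; set xb := avg_iterate x K.
have KR0 : 0 < K%:R :> R by rewrite ltr0n.
have sumx : \sum_(0 <= k < K) (x k - xb) = 0.
  rewrite sumrB sumr_const_nat subn0 -scaler_nat scalerA divff ?gt_eqF//.
  by rewrite scale1r subrr.
have : \sum_(0 <= k < K) (g xb + dotp (gradient g xb) (x k - xb)) <=
    \sum_(0 <= k < K) g (x k).
  by apply: ler_sum => k _; exact: convex_ge_gradient.
rewrite big_split/= sumr_const_nat subn0 -dotp_sumr sumx dotp0r addr0.
by rewrite ler_pdivlMl// mulr_natl.
Qed.

(** * The law of finitely many draws *)

Section draws.
Context {R : realType} {disp : measure_display} {Omega : measurableType disp}.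
Context {P : probability Omega R} {n : nat} {idx : nat -> Omega -> 'I_n}.
Context (hidx : iid_uniform P idx).

(** The event that the first [size s] draws are the entries of [s]; the default
    value [i0] of [nth] plays no role. *)
Definition draws_eq (i0 : 'I_n) (s : seq 'I_n) : set Omega :=
  \bigcap_(k in [set` iota 0 (size s)]) (idx k @^-1` [set nth i0 s k]).

Lemma measurable_draws_eq i0 s : measurable (draws_eq i0 s).
Proof.
have [mi _ _] := hidx.
by apply: fin_bigcap_measurable => // k _; exact: mi.
Qed.

Lemma probability_draws_eq i0 s : P (draws_eq i0 s) = (n%:R^-1 ^+ size s)%:E.
Proof.
have [_ ui ind] := hidx.
rewrite ind ?iota_uniq//.
under eq_bigr do rewrite ui.
rewrite -[in RHS](size_iota 0 (size s)).
elim: (iota _ _) => [|k t IH]; first by rewrite big_nil expr0.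
by rewrite big_cons IH -EFinM -exprS.
Qed.

Lemma draws_eqE i0 (K : nat) (s : K.-tuple 'I_n) w :
  w \in draws_eq i0 s = (s == [tuple of mkseq (idx ^~ w) K]).
Proof.
apply/idP/eqP => [|->]; rewrite inE.
  move=> ws.
  apply: val_inj; apply: (@eq_from_nth _ i0).
    by rewrite !size_tuple.
  move=> k; rewrite (size_tuple s) => kK.
  have /= := ws k; rewrite (size_tuple s) mem_iota => /(_ kK) <-.
  by rewrite nth_mkseq.
by move=> k /=; rewrite size_tuple mem_iota /= => kK; rewrite nth_mkseq.
Qed.

(** The first [K] draws are uniformly distributed on [K]-tuples.  Nonnegativity
    of [G] spares integrability conditions. *)
Lemma expectation_draws (K : nat) (G : seq 'I_n -> R) : (0 < n)%N ->
  (forall s, 0 <= G s) ->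
  'E_P[(fun w => G (mkseq (idx ^~ w) K))]%E =
  (n%:R^-1 ^+ K * \sum_(s : K.-tuple 'I_n) G s)%:E.
Proof.
move=> n0 G0; pose i0 := Ordinal n0.
rewrite unlock.
(* G of the draws is a finite combination of indicators of the events
   draws_eq, exactly one of which occurs. *)
have GE w : (G (mkseq (idx ^~ w) K))%:E =
    (\sum_(s : K.-tuple 'I_n) (G s)%:E * (\1_(draws_eq i0 s) w)%:E)%E.
  rewrite (bigD1 [tuple of mkseq (idx ^~ w) K])//= big1 ?adde0.
    by rewrite indicE (draws_eqE i0 [tuple of mkseq (idx ^~ w) K]) eqxx mule1.
  by move=> s /negPf sw; rewrite indicE draws_eqE sw mule0.
under eq_integral do rewrite GE.
rewrite ge0_integral_sum//; last 2 first.
- move=> s; apply: emeasurable_funM; first exact: measurable_cst.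
  apply/measurable_EFinP; apply: measurable_indic; exact: measurable_draws_eq.
- by move=> s w _; rewrite mule_ge0// lee_fin ?indicE.
rewrite mulr_sumr -sumEFin; apply: eq_bigr => s _.
rewrite ge0_integralZl_EFin//; last first.
  apply/measurable_EFinP; apply: measurable_indic; exact: measurable_draws_eq.
rewrite integral_indic//; last exact: measurable_draws_eq.
by rewrite setIT [X in (_ * X)%E = _]probability_draws_eq size_tuple -EFinM mulrC.
Qed.

End draws.

(** * Averaging over the draws *)

Lemma big_tuple_cons (R : nmodType) (T : finType) (K : nat)
    (F : seq T -> R) :
  \sum_(s : K.+1.-tuple T) F s = \sum_i \sum_(s : K.-tuple T) F (i :: s).
Proof.
rewrite pair_big /=.
pose h (p : T * K.-tuple T) : K.+1.-tuple T := [tuple of p.1 :: p.2].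
rewrite (reindex h) //=.
exists (fun t : K.+1.-tuple T => (thead t, [tuple of behead t])).
  by move=> [i s] _ /=; congr pair; apply: val_inj.
by move=> t _; rewrite /h /= -tuple_eta.
Qed.

Lemma sum_ord_cst (R : pzRingType) (n : nat) (a : R) :
  \sum_(i < n) a = n%:R * a.
Proof. by rewrite sumr_const card_ord mulr_natl. Qed.

Lemma sum_tuple_cst (R : pzRingType) (n K : nat) (a : R) :
  \sum_(s : K.-tuple 'I_n) a = n%:R ^+ K * a.
Proof. by rewrite sumr_const card_tuple card_ord -natrX mulr_natl. Qed.

Section sgd.
Context {R : realType} {d n : nat}.
Context (f : 'I_n -> 'rV[R]_d -> R) (xs : 'rV[R]_d) (gb : R).
Context (n_gt0 : (0 < n)%N).

Let nR_neq0 : n%:R != 0 :> R. Proof. by rewrite pnatr_eq0 -lt0n. Qed.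

(** Peeling off the first draw restarts the method after one step. *)
Lemma sgd_sps_cons c x0 (i0 i : 'I_n) s k :
  sgd_sps c gb f x0 (nth i0 (i :: s)) k.+1 =
  sgd_sps c gb f (sps_step c gb (f i) x0) (nth i0 s) k.
Proof. by elim: k => //= k <-. Qed.

Lemma eq_sgd_sps c x0 (s t : nat -> 'I_n) k :
  (forall j, (j < k)%N -> s j = t j) ->
  sgd_sps c gb f x0 s k = sgd_sps c gb f x0 t k.
Proof.
elim: k => //= k IH st; rewrite st ?IH// => j jk.
by apply: st; exact: ltnW.
Qed.

Lemma sum_gap_avg_fun x :
  \sum_(i < n) (f i x - f i xs) = n%:R * (avg_fun f x - avg_fun f xs).
Proof. by rewrite sumrB /avg_fun -mulrBr mulrA divff// mul1r. Qed.

Lemma sum_gap_sigma2 :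
  \sum_(i < n) (f i xs - inf_val (f i)) = n%:R * sigma2 f xs.
Proof. by rewrite mulrA divff// mul1r. Qed.

Lemma avg_fun_avg_iterate (x : nat -> 'rV[R]_d) K :
  (forall i, convex_function [set: 'rV[R]_d] (f i)) ->
  (forall i y, differentiable (f i) y) -> (0 < K)%N ->
  avg_fun f (avg_iterate x K) - avg_fun f xs <=
    K%:R^-1 * \sum_(0 <= k < K) (avg_fun f (x k) - avg_fun f xs).
Proof.
move=> cf df K0; have KR0 : K%:R != 0 :> R by rewrite pnatr_eq0 -lt0n.
rewrite sumrB sumr_const_nat subn0 mulrBr -[avg_fun f xs *+ K]mulr_natl mulKf//.
rewrite lerD2r -mulr_sumr exchange_big/= mulrCA ler_wpM2l ?invr_ge0//.
by rewrite mulr_sumr; apply: ler_sum => i _; exact: convex_avg_iterate.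
Qed.

(** The bound on the expected sum of the gaps along [K] iterations, with both
    sides multiplied by the number of [K]-tuples.  Induction on [K] with [x0] generalized: the
    induction hypothesis is applied at the point reached by the first step,
    and [sps_step_le] is averaged over the first draw. *)
Lemma sum_tuple_gap_le (L alpha : R) (i0 : 'I_n) K x0 :
  (forall i, convex_function [set: 'rV[R]_d] (f i)) ->
  (forall i, smooth L (f i)) -> (forall i, has_lbound (range (f i))) ->
  0 <= alpha -> alpha <= gb -> 2 * alpha * L <= 1 ->
  alpha * (\sum_(s : K.-tuple 'I_n) \sum_(0 <= k < K)
      (avg_fun f (sgd_sps 1 gb f x0 (nth i0 s) k) - avg_fun f xs)) <=
  n%:R ^+ K * (enorm (x0 - xs) ^+ 2 + K%:R * (2 * gb * sigma2 f xs)).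
Proof.
move=> cf sf lbf a0 agb aL.
elim: K x0 => [|K IH] x0.
  rewrite big1 => [|s _]; last by rewrite big_geq.
  by rewrite mulr0 mul1r mul0r addr0 sqr_ge0.
rewrite (big_tuple_cons _ (fun s => \sum_(0 <= k < K.+1)
  (avg_fun f (sgd_sps 1 gb f x0 (nth i0 s) k) - avg_fun f xs))).
under eq_bigr => i _.
  under eq_bigr => s _.
    rewrite big_nat_recl//.
    under eq_bigr do rewrite sgd_sps_cons.
    over.
  rewrite big_split /= sum_tuple_cst.
  over.
rewrite big_split /= sum_ord_cst mulrDr.
set D := avg_fun f x0 - avg_fun f xs.
have step : \sum_(i < n) enorm (sps_step 1 gb (f i) x0 - xs) ^+ 2 <=
    n%:R * (enorm (x0 - xs) ^+ 2 - alpha * D + 2 * gb * sigma2 f xs).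
  apply: le_trans (ler_sum _ (fun i _ =>
    sps_step_le x0 xs (cf i) (sf i) (lbf i) a0 agb aL)) _.
  rewrite big_split sumrB /= -!mulr_sumr sum_gap_avg_fun sum_gap_sigma2.
  by rewrite sum_ord_cst -/D; lra.
rewrite [X in _ + X]mulr_sumr.
apply: le_trans (lerD (lexx _) (ler_sum _ (fun i _ => IH _))) _.
rewrite -mulr_sumr big_split /= sum_ord_cst.
have nK0 : 0 <= n%:R ^+ K :> R by rewrite exprn_ge0.
have := ler_wpM2l nK0 step.
rewrite [n%:R ^+ K.+1]exprS; lra.
Qed.

End sgd.

(** * The constant alpha and the conclusion *)

Lemma Lmax_ge (R : realType) (n : nat) (L : 'I_n -> R) i : L i <= Lmax L.
Proof. exact: le_bigmax. Qed.

Lemma Lmax_ge0 (R : realType) (n : nat) (L : 'I_n -> R) : 0 <= Lmax L.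
Proof. exact: bigmax_ge_id. Qed.

Lemma smooth_le (R : realType) (d : nat) (L L' : R) (g : 'rV[R]_d -> R) :
  L <= L' -> smooth L g -> smooth L' g.
Proof.
move=> LL' [dg lg]; split=> // x y; apply: le_trans (lg x y) _.
by rewrite ler_wpM2r// enorm_ge0.
Qed.

Lemma sps_alphaP (R : realType) (n : nat) (gb : R) (L : 'I_n -> R) : 0 < gb ->
  [/\ 0 < sps_alpha 1 gb L, sps_alpha 1 gb L <= gb &
      2 * sps_alpha 1 gb L * Lmax L <= 1].
Proof.
move=> gb0; rewrite /sps_alpha; case: eqVneq => [->|Ln0].
  by rewrite mulr0.
have L0 : 0 < Lmax L by rewrite lt_def Ln0 Lmax_ge0.
split; first by rewrite lt_min gb0 andbT divr_gt0// !mulr_gt0.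
  by rewrite ge_min lexx orbT.
rewrite mulrAC mulrC -ler_pdivlMr ?mulr_gt0// ge_min mulr1.
by rewrite lexx.
Qed.

Theorem theorem3p4 (R : realType) (d n : nat) (f : 'I_n -> 'rV[R]_d -> R)
    (L : 'I_n -> R) (xs x0 : 'rV[R]_d) (gb : R)
    (disp : measure_display) (Omega : measurableType disp)
    (P : probability Omega R) (idx : nat -> Omega -> 'I_n)
    (hn : (0 < n)%N)
    (hconvex : forall i, convex_function [set: 'rV[R]_d] (f i))
    (hL : forall i, 0 <= L i)
    (hsmooth : forall i, smooth (L i) (f i))
    (hinf : forall i, has_lbound (range (f i)))
    (hxs : minimizer (avg_fun f) xs)
    (hgb : 0 < gb)
    (hidx : iid_uniform P idx)
    (K : nat) (hK : (1 <= K)%N) :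
  let x (k : nat) (w : Omega) : 'rV[R]_d :=
    sgd_sps 1 gb f x0 (fun j => idx j w) k in
  let xbar (w : Omega) : 'rV[R]_d := avg_iterate (fun k => x k w) K in
  let alpha : R := sps_alpha 1 gb L in
  ('E_P[(fun w => avg_fun f (xbar w) - avg_fun f xs)%R] <=
    (enorm (x0 - xs) ^+ 2 / (alpha * K%:R)
     + 2 * sigma2 f xs * gb / alpha)%:E)%E.
Proof.
cbv zeta; set alpha := sps_alpha 1 gb L.
have [a0 agb aL] : [/\ 0 < alpha, alpha <= gb & 2 * alpha * Lmax L <= 1] :=
  sps_alphaP L hgb.
have sf i : smooth (Lmax L) (f i) := smooth_le (Lmax_ge L i) (hsmooth i).
pose i0 := Ordinal hn.
pose xb (s : seq 'I_n) := avg_iterate (sgd_sps 1 gb f x0 (nth i0 s)) K.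
pose G (s : seq 'I_n) := avg_fun f (xb s) - avg_fun f xs.
have -> : (fun w => avg_fun f (avg_iterate
      (fun k => sgd_sps 1 gb f x0 (fun j => idx j w) k) K) - avg_fun f xs) =
    (fun w => G (mkseq (idx ^~ w) K)).
  apply/funext => w; congr (avg_fun f (_ *: _) - _).
  apply: eq_big_nat => k /andP[_ kK]; apply: eq_sgd_sps => j jk.
  by rewrite nth_mkseq// (ltn_trans jk).
rewrite (expectation_draws hidx)//; last by move=> s; rewrite subr_ge0 hxs.
rewrite lee_fin.
have KR0 : 0 < K%:R :> R by rewrite ltr0n.
have nK0 : 0 < n%:R ^+ K :> R by rewrite exprn_gt0// ltr0n.
have le_sum : \sum_(s : K.-tuple 'I_n) G s <=
    K%:R^-1 * \sum_(s : K.-tuple 'I_n) \sum_(0 <= k < K)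
      (avg_fun f (sgd_sps 1 gb f x0 (nth i0 s) k) - avg_fun f xs).
  rewrite mulr_sumr; apply: ler_sum => s _.
  by apply: avg_fun_avg_iterate => // i; exact: (hsmooth i).1.
have := sum_tuple_gap_le xs hn i0 K x0 hconvex sf hinf (ltW a0) agb aL.
rewrite -ler_pdivlMl// => le_gap.
rewrite exprVn ler_pdivrMl//.
apply: le_trans le_sum _.
rewrite ler_pdivrMl//; apply: le_trans le_gap _.
rewrite le_eqVlt; apply/predU1l.
by field; rewrite !gt_eqF.
Qed.
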